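(* Let $p(x)$ be a cubic polynomial over $\mathbb{Q}$ whose splitting field over $\mathbb{Q}$ has degree $3$. Then the three roots of $p(x)$ pairwise have common tails if and only if $p(x)$ has two distinct roots $r_1, r_2$ such that $r_2 = (\alpha r_1 + \beta)/(\gamma r_1 + \delta)$ for some integers $\alpha, \beta, \gamma, \delta$ with $|\alpha\delta - \beta\gamma| = 1$.
   Context: For irrational real numbers $s = [s_0; s_1, s_2, \dots]$ and $t = [t_0; t_1, t_2, \dots]$ (simple continued fractions), $s$ and $t$ have common tails if there exist $m, n \ge 0$ with $s_{m+k} = t_{n+k}$ for all $k \ge 0$. *)

(* Defs.v *)
From HB Require Import structures.
From mathcomp Require Import all_boot all_order all_algebra all_field.
From mathcomp Require Import reals complex.

Set Implicit Arguments.
Unset Strict Implicit.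
Unset Printing Implicit Defensive.

Import Order.TTheory GRing.Theory Num.Theory.

Local Open Scope ring_scope.
Local Open Scope complex_scope.

(* [complete_quotient s n] is the real [s_n; s_(n+1), ...].  For irrational s
   no complete quotient is an integer, so the inverse is never taken at 0. *)
Fixpoint complete_quotient (R : realType) (s : R) (n : nat) : R :=
  if n is m.+1 then
    let x := complete_quotient s m in (x - (Num.floor x)%:~R)^-1
  else s.

Definition partial_quotient (R : realType) (s : R) (n : nat) : int :=
  Num.floor (complete_quotient s n).

(* Continued fractions of rational numbers terminate, so irrationality is part
   of the notion: the recursion above is meaningless for rational s. *)
Definition common_tails (R : realType) (s t : R) : Prop :=
  [/\ irrational s, irrational t
    & exists m n : nat, forall k : nat,
        partial_quotient s (m + k) = partial_quotient t (n + k)].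

(* Roots of a polynomial are taken in the complex field R[i]; they have common
   tails when they are real and have common tails as real numbers. *)
Definition complex_common_tails (R : realType) (z w : R[i]) : Prop :=
  exists s t : R, [/\ z = s%:C, w = t%:C & common_tails s t].

Definition splitting_field_of (p : {poly rat}) (L : fieldExtType rat) : Prop :=
  splittingFieldFor 1%VS (map_poly (in_alg L) p) {:L}%VS.

(* Main.v *)
(* Write x ~ Mx for a Mobius map M with integer entries and determinant +-1.
   Euclid's algorithm on the first column of M decomposes it into integer
   translations, inversion and negation, and each of these preserves the tail of
   the continued fraction; conversely a common tail is a common complete
   quotient, which is ~ to both numbers.

   A degree 3 splitting field makes p irreducible.  If M maps a root of p to a
   different root, then p divides the numerator of p(Mx), so M permutes the roots,
   and it has no fixed root since p divides no nonzero quadratic polynomial.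
   Hence M is a 3-cycle on the roots.  As M commutes with complex conjugation,
   an involution, all roots are real, and they are pairwise related by M or M^2. *)
Require Import Defs.
From HB Require Import structures.
From mathcomp Require Import all_boot all_order all_algebra all_field.
From mathcomp Require Import reals complex.
From mathcomp Require Import ring lra zify.

Set Implicit Arguments.
Unset Strict Implicit.
Unset Printing Implicit Defensive.

Import Order.TTheory GRing.Theory Num.Theory.

Local Open Scope ring_scope.
Local Open Scope complex_scope.

(** * Irrational reals and nonvanishing of integer linear forms *)

Lemma rationalP (R : realType) (x : R) :
  rational x <-> exists q : rat, x = ratr q.
Proof. by split=> [[q _ <-]|[q ->]]; exists q. Qed.

Lemma irrational_neq_int (R : realType) (x : R) (k : int) :
  irrational x -> x != k%:~R.
Proof.
move=> irr_x; apply/eqP => xk; apply: irr_x; apply/rationalP.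
by exists k%:~R; rewrite ratr_int.
Qed.

Lemma irrational_neq0 (R : realType) (x : R) : irrational x -> x != 0.
Proof. exact: (irrational_neq_int 0). Qed.

Lemma irrationalDz (R : realType) (x : R) (k : int) :
  irrational x -> irrational (x + k%:~R).
Proof.
move=> irr_x /rationalP [q xq]; apply: irr_x; apply/rationalP.
by exists (q - k%:~R); rewrite rmorphB /= ratr_int -xq addrK.
Qed.

Lemma irrationalV (R : realType) (x : R) : irrational x -> irrational x^-1.
Proof.
move=> irr_x /rationalP [q xq]; apply: irr_x; apply/rationalP.
by exists q^-1; rewrite fmorphV /= -xq invrK.
Qed.

Lemma irrationalN (R : realType) (x : R) : irrational x -> irrational (- x).
Proof.
move=> irr_x /rationalP [q xq]; apply: irr_x; apply/rationalP.
by exists (- q); rewrite rmorphN /= -xq opprK.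
Qed.

Lemma irrational_linear_neq0 (R : realType) (x : R) (c d : int) :
  irrational x -> (c != 0) || (d != 0) -> c%:~R * x + d%:~R != 0.
Proof.
move=> irr_x; have [-> /=|c0 _] := eqVneq c 0.
  by rewrite mul0r add0r intr_eq0.
have c0R : c%:~R != 0 :> R by rewrite intr_eq0.
apply/eqP => /eqP; rewrite addr_eq0 => /eqP cxd; apply: irr_x; apply/rationalP.
exists (- (d%:~R / c%:~R)); rewrite rmorphN fmorph_div /= !ratr_int -mulNr -cxd.
by rewrite mulrC mulKf.
Qed.

Lemma unimodular_row_neq0 (a b c d : int) :
  `|a * d - b * c| = 1 -> (c != 0) || (d != 0).
Proof.
case: (eqVneq c 0) => [->|//]; case: (eqVneq d 0) => [->|//].
by rewrite !mulr0 subrr normr0.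
Qed.

(** * The shift on continued fractions *)

Section ContinuedFractions.
Variable R : realType.
Implicit Types (x y s t : R) (m n k : nat).

(** A variant of the classical Gauss map that keeps the integer part of the inverse, so that it acts
    as the shift on partial quotients. *)
Definition gauss_map x : R := (x - (Num.floor x)%:~R)^-1.

Lemma complete_quotientS s n :
  complete_quotient s n.+1 = gauss_map (complete_quotient s n).
Proof. by []. Qed.

Lemma complete_quotient_gauss s n :
  complete_quotient (gauss_map s) n = complete_quotient s n.+1.
Proof. by elim: n => //= n ->. Qed.

Lemma partial_quotient_gauss s n :
  partial_quotient (gauss_map s) n = partial_quotient s n.+1.
Proof. by rewrite /partial_quotient complete_quotient_gauss. Qed.

Lemma complete_quotientD s m n :
  complete_quotient (complete_quotient s m) n = complete_quotient s (m + n).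
Proof. by elim: n => [|n /= ->]; rewrite ?addn0 // addnS. Qed.

Lemma irrational_gauss s : irrational s -> irrational (gauss_map s).
Proof.
by move=> irr_s; apply: irrationalV; rewrite -mulrNz; apply: irrationalDz.
Qed.

Lemma irrational_complete_quotient s n :
  irrational s -> irrational (complete_quotient s n).
Proof. by move=> irr_s; elim: n => //= n; apply: irrational_gauss. Qed.

Lemma gauss_mapK s : s = (Num.floor s)%:~R + (gauss_map s)^-1.
Proof. by rewrite invrK addrC subrK. Qed.

Lemma fract_itv s : irrational s -> 0 < s - (Num.floor s)%:~R < 1.
Proof.
move=> irr_s; have /andP[le_fs lt_sf] := floor_itv s.
have := irrational_neq_int (Num.floor s) irr_s.
move: le_fs lt_sf; rewrite rmorphD /=; set f := (_%:~R); lra.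
Qed.

Lemma gauss_map_gt1 s : irrational s -> 1 < gauss_map s.
Proof. by move=> /fract_itv /andP[s0 s1]; rewrite invf_gt1. Qed.

Lemma gauss_mapDz s (k : int) : gauss_map (s + k%:~R) = gauss_map s.
Proof.
rewrite /gauss_map floorDrz ?intr_int // intrKfloor rmorphD /=.
by congr (_^-1); ring.
Qed.

Lemma gauss_map_unit s : 0 < s < 1 -> gauss_map s = s^-1.
Proof.
move=> /andP[s0 s1]; rewrite /gauss_map (@floor_def _ _ 0) ?subr0 //.
by rewrite add0r s1 ltW.
Qed.

(** * Invariance of tails under unimodular Mobius maps *)

Lemma common_tails_sym s t : common_tails s t -> common_tails t s.
Proof. by case=> irr_s irr_t [m [n eq_st]]; split=> //; exists n, m. Qed.

Lemma common_tails_trans t s u :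
  common_tails s t -> common_tails t u -> common_tails s u.
Proof.
case=> irr_s irr_t [m [n eq_st]] [_ irr_u [m' [n' eq_tu]]]; split=> //.
(* With these shifts both agreements pass through the index [n + m' + k] of [t]. *)
exists (m + m')%N, (n' + n)%N => k.
by rewrite -addnA eq_st addnCA eq_tu addnA.
Qed.

Lemma common_tails_gauss s t :
  irrational s -> irrational t -> gauss_map s = gauss_map t -> common_tails s t.
Proof.
move=> irr_s irr_t eq_st; split=> //; exists 1%N, 1%N => k.
by rewrite !add1n -!partial_quotient_gauss eq_st.
Qed.

Lemma common_tailsDz s (k : int) :
  irrational s -> common_tails s (s + k%:~R).
Proof.
move=> irr_s; apply: common_tails_gauss => //; first exact: irrationalDz.
by rewrite gauss_mapDz.
Qed.

Lemma common_tailsV_lt1 s : irrational s -> 0 < s < 1 -> common_tails s s^-1.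
Proof.
move=> irr_s s01; split=> //; first exact: irrationalV.
(* The expansion of [s] is that of its inverse with a 0 put in front. *)
exists 1%N, 0%N => k.
by rewrite add1n add0n -partial_quotient_gauss gauss_map_unit.
Qed.

(** One of [s] and its inverse lies in the unit interval. *)
Lemma common_tailsV_gt0 s : irrational s -> 0 < s -> common_tails s s^-1.
Proof.
move=> irr_s s0; have [s1|s1|s1] := ltrgtP s 1.
- by apply: common_tailsV_lt1; rewrite ?s0.
- apply: common_tails_sym; rewrite -{2}[s]invrK; apply: common_tailsV_lt1.
    exact: irrationalV.
  by rewrite invr_gt0 s0 invf_lt1.
- by have := irrational_neq_int 1 irr_s; rewrite s1 eqxx.
Qed.

(* -x ~ 1-x ~ 1/(1-x) ~ x/(1-x) ~ 1/x - 1 ~ 1/x ~ x for x in the unit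
   interval, every step being an integer translation or the inversion of a
   positive number. *)
Lemma common_tailsN s : irrational s -> common_tails s (- s).
Proof.
move=> irr_s; set x := s - (Num.floor s)%:~R.
have irr_x : irrational x by rewrite /x -mulrNz; apply: irrationalDz.
have /andP[x0 x1] : 0 < x < 1 := fract_itv irr_s.
have sx : common_tails s x by rewrite /x -mulrNz; apply: common_tailsDz.
have irr_1x : irrational (1 - x).
  by rewrite addrC -[1]/(1%:~R); apply/irrationalDz/irrationalN.
have step1 : common_tails (- s) (1 - x).
  have -> : 1 - x = - s + (Num.floor s + 1)%:~R by rewrite /x rmorphD /=; ring.
  by apply: common_tailsDz; apply: irrationalN.
have step2 : common_tails (1 - x) (1 - x)^-1.
  by apply: common_tailsV_gt0 => //; lra.
have step3 : common_tails (1 - x)^-1 (x / (1 - x)).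
  have -> : x / (1 - x) = (1 - x)^-1 + (- 1 : int)%:~R by field; lra.
  by apply: common_tailsDz; apply: irrationalV.
have step4 : common_tails (x / (1 - x)) (x^-1 - 1).
  have -> : x^-1 - 1 = (x / (1 - x))^-1 by field; apply/andP; lra.
  by apply: common_tailsV_gt0; [case: step3 | apply: divr_gt0; lra].
have step5 : common_tails (x^-1 - 1) x^-1.
  rewrite -[1]/(1%:~R) -mulrNz.
  by apply/common_tails_sym/common_tailsDz/irrationalV.
have step6 : common_tails x^-1 x.
  by apply: common_tails_sym; apply: common_tailsV_gt0.
apply: common_tails_trans sx _; apply: common_tails_sym.
apply: common_tails_trans step1 _; apply: common_tails_trans step2 _.
apply: common_tails_trans step3 _; apply: common_tails_trans step4 _.
exact: common_tails_trans step5 step6.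
Qed.

Lemma common_tailsV s : irrational s -> common_tails s s^-1.
Proof.
move=> irr_s; have [s0|s0|s0] := ltrgtP s 0.
- apply: common_tails_trans (common_tailsN irr_s) _.
  apply: (common_tails_trans (t := (- s)^-1)).
    by apply: common_tailsV_gt0; [apply: irrationalN | rewrite oppr_gt0].
  rewrite invrN; apply/common_tails_sym/common_tailsN.
  exact: irrationalV.
- exact: common_tailsV_gt0.
- by have := irrational_neq0 irr_s; rewrite s0 eqxx.
Qed.

(** Induction on [|c|]. Writing a = qc + r turns Ms into q + 1/Ns, where N has rows (c, d) and (r, b
    - qd); its lower left entry r is smaller than [|c|]. *)
Lemma common_tails_mobius s (a b c d : int) :
  irrational s -> `|a * d - b * c| = 1 ->
  common_tails s ((a%:~R * s + b%:~R) / (c%:~R * s + d%:~R)).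
Proof.
move=> irr_s; have [n] := ubnP `|c|%N.
elim: n a b c d => // n IHn a b c d lt_cn det1.
(* If c = 0, then a and d are units and the map is a translation, possibly after a negation. *)
have [c0|c0] := eqVneq c 0.
  have /eqP : (`|a| * `|d| = 1)%N.
    by rewrite -abszM; move: det1; rewrite c0 mulr0 subr0; lia.
  rewrite muln_eq1 => /andP[/eqP a1 /eqP d1].
  have [k [->|->]] : exists k : int,
      (a%:~R * s + b%:~R) / (c%:~R * s + d%:~R) = s + k%:~R \/
      (a%:~R * s + b%:~R) / (c%:~R * s + d%:~R) = - s + k%:~R.
  - have [->|->] : a = 1 \/ a = -1 by lia.
      have [->|->] : d = 1 \/ d = -1 by lia.
        by exists b; left; rewrite c0; field.
      by exists (- b); right; rewrite c0; field.
    have [->|->] : d = 1 \/ d = -1 by lia.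
      by exists b; right; rewrite c0; field.
    by exists (- b); left; rewrite c0; field.
  - exact: common_tailsDz.
  - apply: common_tails_trans (common_tailsN irr_s) _.
    exact/common_tailsDz/irrationalN.
set q := (a %/ c)%Z; set r := (a %% c)%Z.
have aE : a = q * c + r by exact: divz_eq.
have r_ge0 : 0 <= r by exact: modz_ge0.
have r_lt : r < `|c| by exact: ltz_mod.
have det1' : `|c * (b - q * d) - d * r| = 1.
  by rewrite -det1 -[in RHS]normrN aE; congr (`|_|); ring.
have IH := IHn c d r (b - q * d) _ det1'.
have {}IH := IH ltac:(lia).
have den_neq0 : c%:~R * s + d%:~R != 0 :> R.
  exact: irrational_linear_neq0 irr_s (unimodular_row_neq0 det1).
have num_neq0 : r%:~R * s + (b - q * d)%:~R != 0 :> R.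
  exact: irrational_linear_neq0 irr_s (unimodular_row_neq0 det1').
apply: common_tails_trans IH _.
have -> : (a%:~R * s + b%:~R) / (c%:~R * s + d%:~R) =
    ((c%:~R * s + d%:~R) / (r%:~R * s + (b - q * d)%:~R))^-1 + q%:~R :> R.
  rewrite aE invf_div; move: den_neq0 num_neq0.
  by rewrite !(rmorphD, rmorphB, rmorphM) /= => den0 num0; field.
have irr_t : irrational ((c%:~R * s + d%:~R) / (r%:~R * s + (b - q * d)%:~R)).
  by case: (IHn c d r (b - q * d) ltac:(lia) det1').
apply: common_tails_trans (common_tailsV irr_t) _.
by apply: common_tailsDz; apply: irrationalV.
Qed.

(** * From common tails back to a Mobius map *)

Lemma complete_quotient_mobius s n : irrational s ->
  exists a b c d : int, `|a * d - b * c| = 1 /\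
    complete_quotient s n = (a%:~R * s + b%:~R) / (c%:~R * s + d%:~R).
Proof.
move=> irr_s; elim: n => [|n [a [b [c [d [det1 sn]]]]]].
  exists 1, 0, 0, 1; rewrite mulr1 mul0r subr0 normr1; split=> //=.
  by rewrite !mul1r mul0r add0r divr1 addr0.
rewrite complete_quotientS /gauss_map; set f := Num.floor _.
have den0 : c%:~R * s + d%:~R != 0 :> R.
  exact: irrational_linear_neq0 irr_s (unimodular_row_neq0 det1).
(* The matrix with rows (0, 1) and (1, -f), of determinant -1, is multiplied on the left. *)
exists c, d, (a - f * c), (b - f * d); split.
  by rewrite -det1 -[in RHS]normrN; congr (`|_|); ring.
rewrite -[RHS]invrK invf_div; congr (_^-1).
rewrite sn !rmorphB !rmorphM /=; field; exact: den0.
Qed.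

(* As a function of s2, s has derivative 1 / (s1 s2)^2, and
   s1 s2 = f1 s2 + 1 >= 2. *)
Lemma continued_fraction_contraction s t s1 t1 s2 t2 f0 f1 :
  1 <= f1 -> 1 < s2 -> 1 < t2 ->
  s = f0 + s1^-1 -> t = f0 + t1^-1 -> s1 = f1 + s2^-1 -> t1 = f1 + t2^-1 ->
  2 * `|s - t| <= `|s2 - t2|.
Proof.
move=> f1_ge1 s2_gt1 t2_gt1 sE tE s1E t1E.
have s12 : s1 * s2 = f1 * s2 + 1 by rewrite s1E; field; lra.
have t12 : t1 * t2 = f1 * t2 + 1 by rewrite t1E; field; lra.
have s12_ge2 : 2 <= s1 * s2 by rewrite s12; nra.
have t12_ge2 : 2 <= t1 * t2 by rewrite t12; nra.
have s1_neq0 : s1 != 0 by apply: contraTneq s12_ge2 => ->; lra.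
have t1_neq0 : t1 != 0 by apply: contraTneq t12_ge2 => ->; lra.
(* This combines s - t = (t1 - s1) / (s1 t1) with t1 - s1 = (s2 - t2) / (s2 t2). *)
have -> : s2 - t2 = (s - t) * ((s1 * s2) * (t1 * t2)).
  transitivity ((t1 - s1) * (s2 * t2)); last first.
    by rewrite sE tE; field; apply/andP.
  by rewrite s1E t1E; field; apply/andP; lra.
rewrite normrM mulrC ler_wpM2l // ger0_norm; nra.
Qed.

(** Reals with equal floors differ by less than 1, and two shifts at least double the distance.
    Applied to all iterated shifts, this bounds [|s - t|] by every power of 1/2. *)
Lemma partial_quotient_inj s t : irrational s -> irrational t ->
  (forall k, partial_quotient s k = partial_quotient t k) -> s = t.
Proof.
move=> irr_s irr_t eq_st.
have close n : `|s - t| * 2 ^+ n < 1.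
  elim: n s t irr_s irr_t eq_st => [|n IHn] s t irr_s irr_t eq_st.
    rewrite mulr1; have := eq_st 0%N; rewrite /partial_quotient /= => eq_f.
    have := fract_itv irr_s; have := fract_itv irr_t; rewrite eq_f.
    by rewrite ltr_norml; set f := (_%:~R); lra.
  have irr_s1 := irrational_gauss irr_s; have irr_t1 := irrational_gauss irr_t.
  have irr_s2 := irrational_gauss irr_s1.
  have irr_t2 := irrational_gauss irr_t1.
  have := IHn _ _ irr_s2 irr_t2 _.
  have eq2 k : partial_quotient (gauss_map (gauss_map s)) k =
               partial_quotient (gauss_map (gauss_map t)) k.
    by rewrite !partial_quotient_gauss.
  move=> /(_ eq2).
  have eq0 : Num.floor s = Num.floor t := eq_st 0%N.
  have eq1 : Num.floor (gauss_map s) = Num.floor (gauss_map t) := eq_st 1%N.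
  have := gauss_mapK s; have := gauss_mapK t; rewrite eq0.
  have := gauss_mapK (gauss_map s); have := gauss_mapK (gauss_map t).
  have := gauss_map_gt1 irr_s1; have := gauss_map_gt1 irr_t1.
  have : 1 <= Num.floor (gauss_map t).
    by rewrite floor_ge_int ltW // gauss_map_gt1.
  rewrite eq1 -(ler_int R).
  move: (gauss_map (gauss_map s)) (gauss_map (gauss_map t)) => s2 t2.
  move: (gauss_map s) (gauss_map t) => s1 t1.
  set f0 := (Num.floor t)%:~R; set f1 := (_%:~R).
  move=> f1_ge1 t2_gt1 s2_gt1 t1E s1E tE sE.
  have contr := continued_fraction_contraction f1_ge1 s2_gt1 t2_gt1 sE tE s1E t1E.
  rewrite exprS; apply: le_lt_trans; rewrite mulrA [_ * 2]mulrC.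
  by apply: ler_wpM2r contr; rewrite exprn_ge0.
apply/eqP; rewrite -subr_eq0 -normr_eq0; apply: contraT => st_neq0.
have st_gt0 : 0 < `|s - t| by rewrite lt_def st_neq0 /=.
(* For this exponent, [upper_nthrootP] makes the power of 2 exceed the inverse of [|s - t|]. *)
have := close (Num.bound `|s - t|^-1).
rewrite -ltr_pdivlMl // mulr1 ltNge => /negP[]; apply: ltW.
exact: upper_nthrootP.
Qed.

Lemma mobius_of_common_tails s t : common_tails s t ->
  exists a b c d : int, `|a * d - b * c| = 1 /\
    t = (a%:~R * s + b%:~R) / (c%:~R * s + d%:~R).
Proof.
case=> irr_s irr_t [m [n eq_st]].
have eq_x : complete_quotient s m = complete_quotient t n.
  apply: partial_quotient_inj => [||k]; try exact: irrational_complete_quotient.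
  by have := eq_st k; rewrite /partial_quotient -!complete_quotientD.
have [a [b [c [d [det1 sm]]]]] := complete_quotient_mobius m irr_s.
have [a' [b' [c' [d' [det1' tn]]]]] := complete_quotient_mobius n irr_t.
(* These are the entries of adj(M') M, where Ms = M't is the common complete quotient. The adjugate
   inverts M' up to sign, which a Mobius map does not see. *)
exists (d' * a - b' * c), (d' * b - b' * d), (a' * c - c' * a), (a' * d - c' * b).
have det1'' : `|(d' * a - b' * c) * (a' * d - c' * b)
               - (d' * b - b' * d) * (a' * c - c' * a)| = 1.
  transitivity (`|a * d - b * c| * `|a' * d' - b' * c'|).
    by rewrite -normrM; congr (`|_|); ring.
  by rewrite det1 det1' mulr1.
split=> //.
have := irrational_linear_neq0 irr_s (unimodular_row_neq0 det1'').
have := irrational_linear_neq0 irr_t (unimodular_row_neq0 det1').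
have := irrational_linear_neq0 irr_s (unimodular_row_neq0 det1).
move: eq_x; rewrite sm tn => /eqP eq_x u0 v0 w0.
move: eq_x; rewrite eqr_div // => /eqP eq_x.
apply: (mulIf w0); rewrite divfK // !rmorphB !rmorphM /=.
apply/eqP; rewrite -subr_eq0; apply/eqP.
by rewrite -[RHS](subrr ((a%:~R * s + b%:~R) * (c'%:~R * t + d'%:~R)))
  {1}eq_x; ring.
Qed.

End ContinuedFractions.

(** * Irreducibility of the cubic and its consequences for roots *)

(** A reducible cubic has a rational root q, so p = u (X - q) with u quadratic. The roots generate
    L, so one of them, z, is not rational; its degree divides 3, hence equals 3, yet z would be a
    root of u. *)
Lemma cubic_irreducible_of_split (p : {poly rat}) (L : fieldExtType rat) :
  size p = 4%N -> splitting_field_of p L -> \dim {:L} = 3%N ->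
  irreducible_poly p.
Proof.
move=> p4 [rs p_rs L_rs] dimL; apply: cubic_irreducible; first by rewrite p4.
move=> q; apply/negP => /factor_theorem [u pE].
have [z z_rs zN1] : exists2 z, z \in rs & z \notin 1%VS.
  apply/hasP; rewrite has_predC; apply: contra_eqN dimL => /allP rs1.
  have : (<<1 & rs>> <= 1%VS)%VS by apply/Fadjoin_seqP; split.
  by rewrite L_rs => /dimvS; rewrite dimv1; case: (\dim _) => [|[|[|[|?]]]].
have deg_z : adjoin_degree 1%VS z = 3%N.
  have := field_dimS (subvf <<1%VS; z>>%AS); rewrite dim_Fadjoin dimv1 muln1 dimL.
  move: zN1; rewrite -adjoin_deg_eq1.
  by case: (adjoin_degree _ _) => [|[|[|[|n]]]] // _ /dvdn_leq /(_ isT).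
have u_neq0 : u != 0.
  by apply: contra_eqN p4 => /eqP u0; rewrite pE u0 mul0r size_poly0.
have u3 : size u = 3%N.
  by apply/eqP; rewrite -eqSS -p4 pE size_Mmonic ?monicXsubC // size_XsubC addn2.
have : root (map_poly (in_alg L) p) z.
  by rewrite (eqp_root p_rs) root_prod_XsubC.
rewrite pE rmorphM rootM /= map_polyXsubC root_XsubC orbC.
case/orP=> [/eqP zq|]; first by rewrite zq rpredZ ?mem1v in zN1.
have uK : map_poly (in_alg L) u \is a polyOver 1%VS.
  by apply/polyOver1P; exists u.
by rewrite (root_small_adjoin_poly uK) ?size_map_poly ?u3 ?deg_z // map_poly_eq0
  (negPf u_neq0).
Qed.

(** Otherwise p and q would be coprime over the rationals, hence over F, and could not share a
    root. *)
Lemma irreducible_dvdp_root (F : numFieldType) (p q : {poly rat}) (x : F) :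
  irreducible_poly p -> root (map_poly ratr p) x -> root (map_poly ratr q) x ->
  p %| q.
Proof.
move=> p_irr px0 qx0; apply: contraT; rewrite -irreducible_poly_coprime //.
rewrite -(coprimep_map (@ratr F)) => /coprimep_root /(_ px0).
by move: qx0 => /eqP -> /eqP.
Qed.

Lemma irreducible_root_transfer (F : numFieldType) (p q : {poly rat}) (x y : F) :
  irreducible_poly p -> root (map_poly ratr p) x -> root (map_poly ratr p) y ->
  root (map_poly ratr q) x -> root (map_poly ratr q) y.
Proof.
move=> p_irr px0 py0 /(irreducible_dvdp_root p_irr px0).
by rewrite -(dvdp_map (@ratr F)) => /dvdpP [u ->]; rewrite rootM py0 orbT.
Qed.

Lemma irreducible_roots (F : closedFieldType) (i : {rmorphism rat -> F})
    (p : {poly rat}) : irreducible_poly p ->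
  exists rs : seq F, [/\ uniq rs, (size rs).+1 = size p
    & forall x, root (map_poly i p) x = (x \in rs)].
Proof.
move=> p_irr; have [rs pE] := closed_field_poly_normal (map_poly i p).
have lp_neq0 : lead_coef (map_poly i p) != 0.
  by rewrite lead_coef_map fmorph_eq0 lead_coef_eq0 irredp_neq0.
have eqp_rs : map_poly i p %= \prod_(z <- rs) ('X - z%:P).
  by rewrite {1}pE eqp_scale.
exists rs; split.
- rewrite -separable_prod_XsubC -(eqp_separable eqp_rs) separable_map.
  rewrite unlock irreducible_poly_coprime //.
  have p_gt1 : (1 < size p)%N by case: p_irr.
  have dp_neq0 : p^`() != 0.
    (* In characteristic 0 the top coefficient of the derivative, deg p times the leading
       coefficient of p, is nonzero. So p is coprime to its derivative and its roots are simple. *)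
    have : (p^`())`_(size p).-2 != 0.
      have p1_gt0 : (0 < (size p).-1)%N by rewrite -subn1 subn_gt0.
      rewrite coef_deriv prednK // -lead_coefE mulrn_eq0 negb_or.
      by rewrite -lt0n p1_gt0 lead_coef_eq0 irredp_neq0.
    by apply: contraNneq => ->; rewrite coef0.
  by apply: contraL (lt_size_deriv (irredp_neq0 p_irr)) => /(dvdp_leq dp_neq0);
    rewrite -leqNgt.
- by rewrite -(size_map_poly i p) (eqp_size eqp_rs) size_prod_XsubC.
- by move=> x; rewrite (eqp_root eqp_rs) root_prod_XsubC.
Qed.

(** * Fixed-point-free injections of a three-element set *)

Section ThreeCycle.
Variables (T : eqType) (rs : seq T) (f : T -> T).
Hypotheses (rs_uniq : uniq rs) (rs_size : size rs = 3%N).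
Hypotheses (f_rs : {in rs, forall x, f x \in rs}) (f_inj : {in rs &, injective f}).
Hypothesis f_neq : {in rs, forall x, f x != x}.

Lemma three_cycle x : x \in rs ->
  f (f (f x)) = x /\ {in rs, forall y, [\/ y = x, y = f x | y = f (f x)]}.
Proof.
move=> x_rs; have fx_rs := f_rs x_rs; have ffx_rs := f_rs fx_rs.
have ffx_neq : f (f x) != x.
  (* If f swapped x and f x, the third element z would have nowhere to go: f z would be a fourth
     element. *)
  apply/eqP => ffx; have [z z_rs] : exists2 z, z \in rs & z \notin [:: x; f x].
    apply/hasP; rewrite has_predC; apply/negP => /allP /(uniq_leq_size rs_uniq).
    by rewrite rs_size.
  rewrite !inE negb_or => /andP[zx zfx].
  suff uniq4 : uniq [:: x; f x; z; f z].
    suff : (size [:: x; f x; z; f z] <= size rs)%N by rewrite rs_size.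
    by apply: uniq_leq_size => //; apply/allP; rewrite /= x_rs fx_rs z_rs f_rs.
  rewrite /= !inE !negb_or [x == _]eq_sym f_neq //= [x == z]eq_sym zx /=.
  rewrite [f x == z]eq_sym zfx [z == _]eq_sym f_neq //= andbT.
  by rewrite -{1}ffx !(inj_in_eq f_inj) // eq_sym zfx eq_sym zx.
have orbitE : [:: x; f x; f (f x)] =i rs.
  apply: (uniq_min_size _ _ _).2; rewrite ?rs_size //=.
    rewrite !inE negb_or [x == _]eq_sym f_neq // [x == _]eq_sym ffx_neq /=.
    by rewrite [f x == _]eq_sym f_neq.
  by apply/allP; rewrite /= x_rs fx_rs ffx_rs.
split=> [|y]; last first.
  by rewrite -orbitE !inE => /or3P[]/eqP->;
    [constructor 1|constructor 2|constructor 3].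
(* The third iterate is not f x, by injectivity, nor f (f x), which would then be fixed. *)
have := f_rs ffx_rs; rewrite -orbitE !inE => /or3P[/eqP //||].
  by rewrite (inj_in_eq f_inj) // (negPf ffx_neq).
by rewrite (negPf (f_neq ffx_rs)).
Qed.
End ThreeCycle.

(** * The action of a Mobius map on the roots *)

Section MobiusOnRoots.
Variables (F : numFieldType) (p : {poly rat}) (a b c d : int).
Hypotheses (p_irr : irreducible_poly p) (p_gt3 : (3 < size p)%N).
Hypothesis det1 : `|a * d - b * c| = 1.
Implicit Types (q : {poly rat}) (x y : F).

Local Notation pF := (map_poly ratr p).
Local Notation mob x := ((a%:~R * x + b%:~R) / (c%:~R * x + d%:~R)).

Lemma small_dvdp_eq0 q : (size q <= 3)%N -> p %| q -> q = 0.
Proof.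
move=> q3 p_dvd_q; apply/eqP; apply: contraTT q3 => q0.
by rewrite -ltnNge; apply: leq_trans p_gt3 (dvdp_leq q0 p_dvd_q).
Qed.

Lemma root_irrational x (q : rat) : root pF x -> x != ratr q.
Proof.
move=> px0; apply/eqP => xq.
have : p %| 'X - q%:P.
  by apply: irreducible_dvdp_root px0 _ => //;
    rewrite map_polyXsubC root_XsubC xq.
move=> /small_dvdp_eq0; rewrite size_XsubC => /(_ isT) /eqP.
by rewrite polyXsubC_eq0.
Qed.

Lemma root_linear_neq0 x : root pF x -> c%:~R * x + d%:~R != 0.
Proof.
move=> px0; have := unimodular_row_neq0 det1.
have [-> /=|c0 _] := eqVneq c 0; first by rewrite mul0r add0r intr_eq0.
have c0F : c%:~R != 0 :> F by rewrite intr_eq0.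
apply: contraNneq (root_irrational (- (d%:~R / c%:~R)) px0) => /eqP.
rewrite addr_eq0 => /eqP cxd; apply/eqP.
by rewrite rmorphN fmorph_div /= !ratr_int -mulNr -cxd mulrC mulKf.
Qed.

(** After clearing denominators, vanishing of p at [mob x] is a rational polynomial condition on x,
    so irreducibility transfers it from [x0] to every root. *)
Lemma mobius_root_closed x0 x : root pF x0 -> root pF (mob x0) -> root pF x ->
  root pF (mob x).
Proof.
move=> px0 pmx0 px.
(* Homogenization of p, evaluated at (a X + b, c X + d). *)
pose q : {poly rat} := \sum_(i < size p) p`_i *:
  ((a%:~R *: 'X + b%:~R%:P) ^+ i * (c%:~R *: 'X + d%:~R%:P) ^+ ((size p).-1 - i)).
have qE y : root pF y ->
    (map_poly ratr q).[y] = (c%:~R * y + d%:~R) ^+ (size p).-1 * pF.[mob y].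
  move=> py0; have den0 := root_linear_neq0 py0.
  rewrite rmorph_sum horner_sum [pF.[_]]horner_coef size_map_poly mulr_sumr.
  apply: eq_bigr => i _; rewrite coef_map /= linearZ /= hornerZ.
  rewrite rmorphM hornerM !rmorphXn /= !horner_exp !rmorphD /= !hornerD.
  rewrite !linearZ /= !map_polyX !map_polyC /= !hornerZ !hornerX !hornerC !ratr_int.
  have i_le : (i <= (size p).-1)%N.
    by rewrite -ltnS prednK ?ltn_ord // (leq_trans _ p_gt3).
  rewrite expr_div_n -[in RHS](subnK i_le) exprD.
  by field; rewrite expf_neq0.
have : root (map_poly ratr q) x.
  apply: (irreducible_root_transfer p_irr px0 px).
  by rewrite /root (qE _ px0) (eqP pmx0) mulr0.
by rewrite /root (qE _ px) mulf_eq0 expf_eq0 (negPf (root_linear_neq0 px)) andbF.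
Qed.

Lemma mobius_inj x y : root pF x -> root pF y -> mob x = mob y -> x = y.
Proof.
move=> /root_linear_neq0 x0 /root_linear_neq0 y0 /eqP; rewrite eqr_div //.
move=> /eqP eq_xy; have : (a * d - b * c)%:~R * (x - y) = 0 :> F.
  rewrite rmorphB !rmorphM /=; set A := (_ * _ : F) in eq_xy.
  by rewrite -[RHS](subrr A) {2}eq_xy /A; ring.
move=> /eqP; rewrite mulf_eq0 intr_eq0 -normr_eq0 det1 /= subr_eq0.
by move=> /eqP.
Qed.

(** Being fixed means being a root of the rational polynomial c X^2 + (d - a) X - b, and this
    transfers between roots of p. Hence a single moved root shows that no root is fixed. *)
Lemma mobius_fixed_root x y : root pF x -> root pF y -> mob x = x -> mob y = y.
Proof.
pose q : {poly rat} := c%:~R *: 'X^2 + (d - a)%:~R *: 'X - b%:~R%:P.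
have qE (z : F) : root pF z -> (mob z == z) = root (map_poly ratr q) z.
  move=> pz0; have den0 := root_linear_neq0 pz0.
  have qz : mob z - z = - (map_poly ratr q).[z] / (c%:~R * z + d%:~R).
    rewrite rmorphB rmorphD /= !linearZ /= map_polyX map_polyXn map_polyC /=.
    by rewrite !hornerE !ratr_int rmorphB /=; field.
  by rewrite -subr_eq0 qz mulf_eq0 invr_eq0 (negPf den0) orbF oppr_eq0.
move=> px0 py0 /eqP; rewrite qE // => qx0; apply/eqP; rewrite qE //.
exact: (irreducible_root_transfer p_irr px0 py0 qx0).
Qed.

End MobiusOnRoots.

(** * The 3-cycle against complex conjugation *)

Section RealRoots.
Variables (R : realType) (p : {poly rat}) (a b c d : int).
Hypotheses (p_irr : irreducible_poly p) (p_cubic : size p = 4%N).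
Hypothesis det1 : `|a * d - b * c| = 1.
Implicit Types (x y : R[i]).

Local Notation pC := (map_poly ratr p).
Local Notation mob x := ((a%:~R * x + b%:~R) / (c%:~R * x + d%:~R)).

Lemma conjc_int (k : int) : (k%:~R : R[i])^*%C = k%:~R.
Proof. exact: (rmorph_int (@conjc R)). Qed.

Lemma root_conjc x : root pC x -> root pC x^*%C.
Proof.
rewrite -complex_root_conj /= -map_poly_comp.
by rewrite (eq_map_poly (g := ratr)) // => q /=; rewrite fmorph_rat.
Qed.

Lemma conjc_fixed_real x : x^*%C = x -> exists s : R, x = s%:C.
Proof. by case: x => u v [vN]; exists u; congr (_ +i* _); lra. Qed.

Lemma conjc_mobius x : (mob x)^*%C = mob x^*%C.
Proof. by rewrite rmorphM fmorphV !rmorphD !rmorphM /= !conjc_int. Qed.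

Lemma mobius_three_cycle x0 : root pC x0 -> root pC (mob x0) -> mob x0 != x0 ->
  forall x y, root pC x -> root pC y ->
  mob (mob (mob x)) = x /\ [\/ y = x, y = mob x | y = mob (mob x)].
Proof.
move=> px0 pmx0 mx0_neq x y px py; have p_gt3 : (3 < size p)%N by rewrite p_cubic.
have [rs [rs_uniq rs_size rsP]] := irreducible_roots (@ratr R[i]) p_irr.
have [||||| -> orb] := @three_cycle _ rs (fun z => mob z) rs_uniq _ _ _ _ x.
- by apply/eqP; rewrite -eqSS rs_size p_cubic.
- by move=> z; rewrite -!rsP; apply: mobius_root_closed px0 pmx0.
- by move=> u v; rewrite -!rsP; apply: mobius_inj.
- move=> z; rewrite -rsP => pz; apply: contra mx0_neq => /eqP mz; apply/eqP.
  exact: (mobius_fixed_root p_irr p_gt3 det1 pz px0 mz).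
- by rewrite -rsP.
by split=> //; apply: orb; rewrite -rsP.
Qed.

(** If conjugation sent x to Mx or to MMx, applying it twice would give x = MMx or x = MMMMx. As
    MMMx = x, either one makes x a fixed root. *)
Lemma mobius_root_real x0 : root pC x0 -> root pC (mob x0) -> mob x0 != x0 ->
  forall x, root pC x -> exists s : R, x = s%:C.
Proof.
move=> px0 pmx0 mx0_neq x px; have cycle := mobius_three_cycle px0 pmx0 mx0_neq.
have p_gt3 : (3 < size p)%N by rewrite p_cubic.
have mx_neq y : root pC y -> mob y <> y.
  move=> py my; case/eqP: mx0_neq.
  exact: (mobius_fixed_root p_irr p_gt3 det1 py).
have [m3 [conj_x|conj_x|conj_x]] := cycle x _ px (root_conjc px).
- exact: conjc_fixed_real.
- have := conjc_mobius x; rewrite -conj_x conjcK => x_mm.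
  by rewrite -conj_x -x_mm in m3; case: (mx_neq _ px).
- have := conjc_mobius (mob x); rewrite -conj_x conjcK conjc_mobius.
  by rewrite conj_x m3 => /esym/(mx_neq _ px).
Qed.

Lemma mobius_root_common_tails x0 :
  root pC x0 -> root pC (mob x0) -> mob x0 != x0 ->
  forall x, root pC x -> complex_common_tails x (mob x).
Proof.
move=> px0 pmx0 mx0_neq x px.
have [s xs] := mobius_root_real px0 pmx0 mx0_neq px.
have p_gt3 : (3 < size p)%N by rewrite p_cubic.
exists s, (mob s); split=> //.
  by rewrite xs rmorphM fmorphV !rmorphD !rmorphM /= !rmorph_int.
apply: common_tails_mobius det1 => /rationalP [q sq].
have /eqP[] := root_irrational p_irr p_gt3 q px.
by rewrite xs sq fmorph_rat.
Qed.

End RealRoots.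

(** * The equivalence *)

Lemma complex_common_tails_trans (R : realType) (y x z : R[i]) :
  complex_common_tails x y -> complex_common_tails y z ->
  complex_common_tails x z.
Proof.
case=> s [t [-> -> st]] [t' [u [/complexI tt' -> t'u]]].
by exists s, u; split=> //; apply: common_tails_trans st _; rewrite tt'.
Qed.

Unset Implicit Arguments.

Theorem theorem3p4 (R : realType) (p : {poly rat}) (L : fieldExtType rat)
    (p_cubic : size p = 4%N)
    (L_split : splitting_field_of p L)
    (L_deg : \dim {:L} = 3%N) :
  (forall r1 r2 : R[i],
      root (map_poly ratr p) r1 -> root (map_poly ratr p) r2 -> r1 != r2 ->
      complex_common_tails r1 r2)
  <->
  (exists r1 r2 : R[i],
      [/\ root (map_poly ratr p) r1, root (map_poly ratr p) r2, r1 != r2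
        & exists a b c d : int,
            `|a * d - b * c| = 1
            /\ r2 = (a%:~R * r1 + b%:~R) / (c%:~R * r1 + d%:~R)]).
Proof.
have p_irr := cubic_irreducible_of_split p_cubic L_split L_deg.
split=> [tails|[r1 [r2 [pr1 pr2 r12 [a [b [c [d [det1 r2E]]]]]]]] x y px py xy].
  (* Irreducibility gives three distinct roots; any two of them serve as witnesses. *)
  have [rs [rs_uniq rs_size rsP]] := irreducible_roots (@ratr R[i]) p_irr.
  case: rs rs_uniq rs_size rsP => [|x [|y rs]]; rewrite p_cubic //.
  rewrite /= inE negb_or => /andP[/andP[xy _] _] _ rsP.
  have px : root (map_poly ratr p) x by rewrite rsP inE eqxx.
  have py : root (map_poly ratr p) y by rewrite rsP !inE eqxx orbT.
  have [s [t [xs yt /mobius_of_common_tails]]] := tails x y px py xy.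
  move=> [a [b [c [d [det1 tE]]]]]; exists x, y; split=> //.
  exists a, b, c, d; split=> //.
  by rewrite xs yt tE rmorphM fmorphV !rmorphD !rmorphM /= !rmorph_int.
rewrite r2E in pr2 r12; rewrite eq_sym in r12.
have tails := mobius_root_common_tails p_irr p_cubic det1 pr1 pr2 r12.
have [_ [yx|->|->]] := mobius_three_cycle p_irr p_cubic det1 pr1 pr2 r12 px py.
- by rewrite yx eqxx in xy.
- exact: tails.
(* Here y = MMx is reached through Mx, which is again a root. *)
- apply: complex_common_tails_trans (tails _ px) (tails _ _).
  by apply: mobius_root_closed pr1 pr2 px => //; rewrite p_cubic.
Qed.
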